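(* Let $\{x_k\}_{k\ge0}$ be the sequence of random iterates generated by the SSKM algorithm (defined in the context) from a starting point $x_0\in\mathbb{R}^n$, with parameters $0<\delta<2$ and $\gamma\ge0$ such that $$\gamma\delta\sqrt{\mu_2}<(\sqrt n-\gamma)\left(1-\sqrt{h(\delta)}\right).$$ Put $\Pi_1=\sqrt{h(\delta)}$, $\Pi_2=\Pi_4=\frac{\gamma}{\sqrt n}$, $\Pi_3=\delta\sqrt{\mu_2}$, $D=(\Pi_1-\Pi_4)^2+4\Pi_2\Pi_3$, and $$\Gamma_1=\frac{\Pi_1-\Pi_4+\sqrt{D}}{2\Pi_3},\quad \Gamma_2=\frac{\Pi_1-\Pi_4-\sqrt{D}}{2\Pi_3},\quad \Gamma_3=\frac{\Pi_3}{\sqrt{D}},\quad \rho_1=\tfrac12\left[\Pi_1+\Pi_4-\sqrt{D}\right],\quad \rho_2=\tfrac12\left[\Pi_1+\Pi_4+\sqrt{D}\right].$$ Then the sequence of iterates $\{x_k\}$ converges and the following bounds hold: $$\mathbb{E}[d(x_{k+1},P)]\le\left(-\Gamma_2\Gamma_3\,\rho_1^k+\Gamma_1\Gamma_3\,\rho_2^k\right)d(x_0,P)\le\rho_2^k\,d(x_0,P),$$ $$\mathbb{E}[\|x_{k+1}-x_k\|]\le\left(-\Gamma_3\,\rho_1^k+\Gamma_3\,\rho_2^k\right)d(x_0,P)\le2\Gamma_3\,\rho_2^k\,d(x_0,P),$$ where $\Gamma_3\ge0$ and $0\le|\rho_1|\le\rho_2<1$.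
   Context: Setting: $A\in\mathbb{R}^{m\times n}$ has rows $a_1^T,\dots,a_m^T$ with $\|a_i\|=1$ for all $i$, $b\in\mathbb{R}^m$, and $P=\{x\in\mathbb{R}^n: Ax\le b\}$ is nonempty. $\|\cdot\|$ is the Euclidean norm, $d(x,P)=\inf_{z\in P}\|x-z\|$, $u^+=\max\{u,0\}$ (componentwise for vectors). Fix a sample size $\beta\in\{1,\dots,m\}$. SSKM algorithm (Stochastic-Momentum Sampling Kaczmarz Motzkin): given $x_0\in\mathbb{R}^n$, set $x_1=x_0$; for $k\ge1$, choose a subset $\tau_k\subseteq\{1,\dots,m\}$ of size $\beta$ uniformly at random, let $i^*\in\arg\max_{i\in\tau_k}(a_i^Tx_k-b_i)^+$, pick $j_k\in\{1,\dots,n\}$ uniformly at random, and set $$x_{k+1}=x_k-\delta\,(a_{i^*}^Tx_k-b_{i^*})^+a_{i^*}+\gamma\,(x_k-x_{k-1})_{j_k}e_{j_k},$$ where $(v)_j$ is the $j$th coordinate of $v$ and $e_j$ the $j$th standard unit vector of $\mathbb{R}^n$. Constants: $L>0$ is a Hoffman constant, i.e. $d(x,P)^2\le L^2\|(Ax-b)^+\|^2$ for all $x\in\mathbb{R}^n$; $\mu_1=\frac{1}{mL^2}$; $\mu_2=\min\{1,\frac{\beta}{m}\lambda_{\max}(A^TA)\}$; $h(\delta)=1-(2\delta-\delta^2)\mu_1$. One has $0<\mu_1\le\mu_2\le1$.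
   Formalization: The displayed bounds are stated only for D ≠ 0, since Γ₃ = Π₃/√D is undefined when D = 0 (this happens only if γ = 0, δ = 1, μ₁ = 1, e.g. m = 1, L = 1); convergence is read as almost sure and holds in all cases. *)

(* Defs.v *)
From HB Require Import structures.
From mathcomp Require Import all_boot all_order all_algebra.
From mathcomp Require Import all_classical all_reals all_analysis.
Set Implicit Arguments.
Unset Strict Implicit.
Unset Printing Implicit Defensive.
Import Order.TTheory GRing.Theory Num.Theory.
Import numFieldNormedType.Exports.
Local Open Scope classical_set_scope.
Local Open Scope ring_scope.

(* Euclidean norm: the library norm [`|x|] on matrices is the sup norm. *)
Definition enorm (R : realType) (p : nat) (x : 'cV[R]_p) : R :=
  Num.sqrt (\sum_i x i 0 ^+ 2).

Definition posp (R : realType) (u : R) : R := Num.max u 0.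

Definition polyhedron (R : realType) (m n : nat) (A : 'M[R]_(m, n))
    (b : 'cV[R]_m) : set 'cV[R]_n :=
  [set x | forall i, (A *m x) i 0 <= b i 0].

Definition dist_set (R : realType) (n : nat) (x : 'cV[R]_n) (S : set 'cV[R]_n) : R :=
  inf [set enorm (x - z) | z in S].

Definition residual (R : realType) (m n : nat) (A : 'M[R]_(m, n))
    (b : 'cV[R]_m) (x : 'cV[R]_n) : 'cV[R]_m :=
  map_mx (@posp R) (A *m x - b).

Definition Hoffman_constant (R : realType) (m n : nat) (A : 'M[R]_(m, n))
    (b : 'cV[R]_m) (L : R) : Prop :=
  0 < L /\
  forall x, dist_set x (polyhedron A b) ^+ 2 <= L ^+ 2 * enorm (residual A b x) ^+ 2.

(* Only applied to symmetric matrices of positive size, whose set of real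
   eigenvalues is finite and nonempty, so that this supremum is a maximum. *)
Definition lambda_max (R : realType) (n : nat) (M : 'M[R]_n) : R :=
  sup [set a : R | eigenvalue M a].

Definition mu1 (R : realType) (m : nat) (L : R) : R := 1 / (m%:R * L ^+ 2).

Definition mu2 (R : realType) (m n : nat) (A : 'M[R]_(m, n)) (beta : nat) : R :=
  Num.min 1 (beta%:R / m%:R * lambda_max (A^T *m A)).

Definition hfun (R : realType) (mu delta : R) : R :=
  1 - (2 * delta - delta ^+ 2) * mu.

(* [F k] is the information available when iteration [k] starts ([F 0] plays
   no role).  Only the choices made at iterations [k >= 1] matter.
   The maximizing index [istar k] is an arbitrary non-anticipating selection:
   ties may be broken by any deterministic or randomized rule, as long as the
   rule does not look at samples drawn after iteration [k].
   [sskm_uniform] says that, given [F k], the pair [(tau k, j k)] is uniform on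
   the product of the set of [beta]-subsets and the set of coordinates; that is,
   [tau k] and [j k] are uniform, independent of each other and of the past. *)
Record SSKM (d : measure_display) (T : measurableType d) (R : realType)
    (Pr : probability T R) (m n : nat) (A : 'M[R]_(m, n)) (b : 'cV[R]_m)
    (beta : nat) (delta gamma : R) (x0 : 'cV[R]_n)
    (F : nat -> set (set T)) (tau : nat -> T -> {set 'I_m})
    (istar : nat -> T -> 'I_m) (j : nat -> T -> 'I_n)
    (x : nat -> T -> 'cV[R]_n) : Prop := MkSSKM {
  sskm_sigma_algebra : forall k, sigma_algebra [set: T] (F k) ;
  sskm_measurable : forall k, F k `<=` measurable ;
  sskm_filtration : forall k, F k `<=` F k.+1 ;
  sskm_tau_adapted : forall k, (0 < k)%N ->
    forall t, F k.+1 [set w | tau k w = t] ;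
  sskm_istar_adapted : forall k, (0 < k)%N ->
    forall i, F k.+1 [set w | istar k w = i] ;
  sskm_j_adapted : forall k, (0 < k)%N ->
    forall l, F k.+1 [set w | j k w = l] ;
  sskm_tau_size : forall k w, (0 < k)%N -> #|tau k w| = beta ;
  sskm_uniform : forall k, (0 < k)%N ->
    forall (E : set T) (t : {set 'I_m}) (l : 'I_n), F k E -> #|t| = beta ->
    Pr (E `&` [set w | tau k w = t] `&` [set w | j k w = l]) =
    (Pr E * ((('C(m, beta))%:R)^-1 * (n%:R)^-1)%:E)%E ;
  sskm_istar_mem : forall k w, (0 < k)%N -> istar k w \in tau k w ;
  sskm_istar_max : forall k w i, (0 < k)%N -> i \in tau k w ->
    residual A b (x k w) i 0 <= residual A b (x k w) (istar k w) 0 ;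
  sskm_x0 : forall w, x 0%N w = x0 ;
  sskm_x1 : forall w, x 1%N w = x0 ;
  sskm_step : forall k w, (0 < k)%N ->
    x k.+1 w = x k w
      - (delta * residual A b (x k w) (istar k w) 0) *: (row (istar k w) A)^T
      + (gamma * (x k w - x k.-1 w) (j k w) 0) *: delta_mx (j k w) 0
}.

(* Main.v *)
(* Write d(y) for the distance to P and let G_k, Z_k be the means of d(x_{k+1})
   and |x_{k+1} - x_k|.  Given the past, the mean of the squared largest sampled
   residual lies between mu1 d^2 (a maximum dominates the average over the
   sample) and mu2 d^2 (it is at most d^2, and at most the sum over the sample),
   and the mean of |v_j| is at most |v| / sqrt n.  Since a relaxed projection
   step lowers d^2 by at least (2 delta - delta^2) times the squared residual,
   Jensen's inequality gives
     G_{k+1} <= Pi1 G_k + Pi2 Z_k,   Z_{k+1} <= Pi3 G_k + Pi4 Z_k,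
   with G_0 = d(x_0) and Z_0 = 0.  The bounds are the closed form of this linear
   recursion.  Summing it gives sum_k Z_k < oo, also when D = 0, so the series of
   steps is almost surely absolutely convergent.  The iterates take finitely many
   values, so all conditional expectations are finite sums. *)
Require Import Defs.
From HB Require Import structures.
From mathcomp Require Import all_boot all_order all_algebra.
From mathcomp Require Import all_classical all_reals all_analysis.
From mathcomp Require Import measurable_realfun.
From mathcomp Require Import ring lra.
Import Order.TTheory GRing.Theory Num.Theory.
Import numFieldNormedType.Exports.
Local Open Scope classical_set_scope.
Local Open Scope ring_scope.

(** * Euclidean geometry *)

(** For [c > 0] evaluate at the minimizer [- b / c]. For [c = 0] the function is affine, and if [b]
    were nonzero the chosen [t] would give the value -1. *)
Lemma discriminant_le0 {R : realFieldType} (a b c : R) :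
  0 <= c -> (forall t, 0 <= a + 2 * t * b + t ^+ 2 * c) -> b ^+ 2 <= a * c.
Proof.
rewrite le_eqVlt => /predU1P[<-|c0] H; last first.
  have := H (- b / c); rewrite -(pmulr_lge0 _ c0).
  suff -> : (a + 2 * (- b / c) * b + (- b / c) ^+ 2 * c) * c = a * c - b ^+ 2.
    by rewrite subr_ge0.
  by field; exact: lt0r_neq0.
have [->|b0] := eqVneq b 0; first by rewrite expr0n mulr0.
have := H (- (a + 1) / (2 * b)).
suff -> : a + 2 * (- (a + 1) / (2 * b)) * b + (- (a + 1) / (2 * b)) ^+ 2 * 0
          = -1 by rewrite ler0N1.
by field.
Qed.

Lemma sum_CauchySchwarz {R : realFieldType} {I : finType} (P : pred I)
    (f g : I -> R) :
  (\sum_(i | P i) f i * g i) ^+ 2 <=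
  (\sum_(i | P i) f i ^+ 2) * \sum_(i | P i) g i ^+ 2.
Proof.
apply: discriminant_le0 => [|t]; first by apply: sumr_ge0 => i _; exact: sqr_ge0.
suff -> : \sum_(i | P i) f i ^+ 2 + 2 * t * (\sum_(i | P i) f i * g i) +
   t ^+ 2 * (\sum_(i | P i) g i ^+ 2) = \sum_(i | P i) (f i + t * g i) ^+ 2.
  by apply: sumr_ge0 => i _; exact: sqr_ge0.
rewrite !mulr_sumr -!big_split; apply: eq_bigr => i _ /=; ring.
Qed.

(** Cauchy-Schwarz against the constant 1. This is the finite Jensen inequality that turns second
    moments into first moments. *)
Lemma sqr_sum_le_card {R : realFieldType} {I : finType} (P : pred I)
    (f : I -> R) :
  (\sum_(i | P i) f i) ^+ 2 <= #|P|%:R * \sum_(i | P i) f i ^+ 2.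
Proof.
have := sum_CauchySchwarz P (fun=> 1) f.
under eq_bigr do rewrite mul1r.
by under [X in _ <= X * _]eq_bigr do rewrite expr1n; rewrite sumr_const.
Qed.

Definition dotp {R : realType} {p : nat} (u v : 'cV[R]_p) : R := (u^T *m v) 0 0.

Lemma dotpE {R : realType} {p} (u v : 'cV[R]_p) :
  dotp u v = \sum_i u i 0 * v i 0.
Proof. by rewrite /dotp mxE; apply: eq_bigr => i _; rewrite mxE. Qed.

Lemma dotpC {R : realType} {p} (u v : 'cV[R]_p) : dotp u v = dotp v u.
Proof. by rewrite !dotpE; apply: eq_bigr => i _; rewrite mulrC. Qed.

Lemma dotpDr {R : realType} {p} (u v w : 'cV[R]_p) :
  dotp u (v + w) = dotp u v + dotp u w.
Proof. by rewrite /dotp mulmxDr mxE. Qed.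

Lemma dotpZr {R : realType} {p} a (u v : 'cV[R]_p) :
  dotp u (a *: v) = a * dotp u v.
Proof. by rewrite /dotp -scalemxAr mxE. Qed.

Lemma dotpDl {R : realType} {p} (u v w : 'cV[R]_p) :
  dotp (v + w) u = dotp v u + dotp w u.
Proof. by rewrite dotpC dotpDr !(dotpC u). Qed.

Lemma dotpZl {R : realType} {p} a (u v : 'cV[R]_p) :
  dotp (a *: v) u = a * dotp v u.
Proof. by rewrite dotpC dotpZr dotpC. Qed.

Lemma dotp_mxl {R : realType} {m n} (B : 'M[R]_(m, n)) u v :
  dotp (B *m u) v = dotp u (B^T *m v).
Proof. by rewrite /dotp trmx_mul mulmxA. Qed.

Lemma dotp_ge0 {R : realType} {p} (u : 'cV[R]_p) : 0 <= dotp u u.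
Proof. by rewrite dotpE; apply: sumr_ge0 => i _; rewrite -expr2 sqr_ge0. Qed.

Lemma dotp_gt0 {R : realType} {p} (u : 'cV[R]_p) : u != 0 -> 0 < dotp u u.
Proof.
move=> u0; rewrite lt_def dotp_ge0 andbT; apply: contra u0 => /eqP.
rewrite dotpE => /psumr_eq0P u0; apply/eqP/colP => i; rewrite mxE.
have /eqP := u0 (fun i _ => ltac:(by rewrite -expr2 sqr_ge0)) i isT.
by rewrite mulf_eq0 orbb => /eqP.
Qed.

Lemma enorm_ge0 {R : realType} {p} (u : 'cV[R]_p) : 0 <= enorm u.
Proof. exact: sqrtr_ge0. Qed.

Lemma sqr_enorm {R : realType} {p} (u : 'cV[R]_p) : enorm u ^+ 2 = dotp u u.
Proof.
rewrite sqr_sqrtr; last by apply: sumr_ge0 => i _; exact: sqr_ge0.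
by rewrite dotpE; apply: eq_bigr => i _; rewrite expr2.
Qed.

Lemma enormZ {R : realType} {p} a (u : 'cV[R]_p) : enorm (a *: u) = `|a| * enorm u.
Proof.
apply/eqP; rewrite -(eqrXn2 (n := 2)) ?enorm_ge0 ?mulr_ge0 ?enorm_ge0 // exprMn !sqr_enorm.
by rewrite dotpZr dotpZl mulrA -expr2 real_normK ?num_real.
Qed.

Lemma dotp_le {R : realType} {p} (u v : 'cV[R]_p) :
  dotp u v <= enorm u * enorm v.
Proof.
apply: le_trans (ler_norm _) _.
rewrite -ler_sqr ?nnegrE ?mulr_ge0 ?enorm_ge0 // real_normK ?num_real //.
rewrite exprMn !sqr_enorm !dotpE; apply: le_trans (sum_CauchySchwarz _ _ _) _.
by under eq_bigr do rewrite expr2; under [X in _ * X]eq_bigr do rewrite expr2.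
Qed.

Lemma enormD {R : realType} {p} (u v : 'cV[R]_p) :
  enorm (u + v) <= enorm u + enorm v.
Proof.
rewrite -ler_sqr ?nnegrE ?addr_ge0 ?enorm_ge0 // sqr_enorm dotpDr !dotpDl.
have := dotp_le u v; rewrite sqrrD !sqr_enorm (dotpC v u); lra.
Qed.

Lemma enorm0 {R : realType} {p} : enorm (0 : 'cV[R]_p) = 0.
Proof. by rewrite -[0](scale0r 0) enormZ normr0 mul0r. Qed.

Lemma enormN {R : realType} {p} (u : 'cV[R]_p) : enorm (- u) = enorm u.
Proof. by rewrite -scaleN1r enormZ normrN1 mul1r. Qed.

Lemma enorm_delta {R : realType} {p} (i : 'I_p) :
  enorm (delta_mx i 0 : 'cV[R]_p) = 1.
Proof.
rewrite /enorm (bigD1 i) //= big1 => [|k ki]; last first.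
  by rewrite mxE (negbTE ki) expr0n.
by rewrite mxE !eqxx expr1n addr0 sqrtr1.
Qed.

Lemma norm_coord_le_enorm {R : realType} {p} (u : 'cV[R]_p) i :
  `|u i 0| <= enorm u.
Proof.
rewrite -sqrtr_sqr; apply: ler_wsqrtr; rewrite (bigD1 i) //= lerDl.
by apply: sumr_ge0 => k _; exact: sqr_ge0.
Qed.

Lemma sum_norm_coord_le {R : realType} {p} (u : 'cV[R]_p) :
  \sum_i `|u i 0| <= Num.sqrt p%:R * enorm u.
Proof.
rewrite -sqrtrM // -[leLHS]ger0_norm ?sumr_ge0 // -sqrtr_sqr ler_wsqrtr //.
apply: le_trans (sqr_sum_le_card _ _) _; rewrite card_ord.
by under eq_bigr do rewrite real_normK ?num_real //.
Qed.

(** * Distance to a nonempty set *)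

Section distance.
Context {R : realType} {n : nat} (S : set 'cV[R]_n).
Hypothesis S0 : S !=set0.

Lemma dist_set_le (y z : 'cV[R]_n) : S z -> dist_set y S <= enorm (y - z).
Proof.
move=> Sz; apply: ge_inf; last by exists z.
by exists 0 => _ [u _ <-]; exact: enorm_ge0.
Qed.

Lemma le_dist_set (y : 'cV[R]_n) c :
  (forall z, S z -> c <= enorm (y - z)) -> c <= dist_set y S.
Proof.
move=> H; apply: lb_le_inf => [|_ [u Su <-]]; last exact: H.
by case: S0 => z Sz; exists (enorm (y - z)); exists z.
Qed.

Lemma dist_set_ge0 (y : 'cV[R]_n) : 0 <= dist_set y S.
Proof. by apply: le_dist_set => z _; exact: enorm_ge0. Qed.

Lemma dist_set_lipschitz (y u : 'cV[R]_n) :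
  dist_set (y + u) S <= dist_set y S + enorm u.
Proof.
rewrite -lerBlDr; apply: le_dist_set => z Sz; rewrite lerBlDr.
apply: le_trans (dist_set_le _ _ Sz) _.
by rewrite addrAC; exact: enormD.
Qed.

(** Lets squared estimates be proved against each point of [S], so that no nearest point has to be
    chosen. *)
Lemma le_dist_set_sqr (y : 'cV[R]_n) c :
  (forall z, S z -> c <= enorm (y - z) ^+ 2) -> c <= dist_set y S ^+ 2.
Proof.
move=> H; have [c0|c0] := leP c 0; first exact: le_trans c0 (sqr_ge0 _).
rewrite -(sqr_sqrtr (ltW c0)) ler_sqr ?nnegrE ?sqrtr_ge0 ?dist_set_ge0 //.
apply: le_dist_set => z /H cz.
by rewrite -[leRHS]ger0_norm ?enorm_ge0 // -sqrtr_sqr ler_wsqrtr.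
Qed.

End distance.

(** * Largest eigenvalue and Rayleigh quotient *)

Section Rayleigh.
Context {R : realType} {n : nat}.
Implicit Types M N : 'M[R]_n.

Lemma psd_CauchySchwarz N : N^T = N -> (forall v, 0 <= dotp v (N *m v)) ->
  forall v w, dotp v (N *m w) ^+ 2 <= dotp v (N *m v) * dotp w (N *m w).
Proof.
move=> Nsym N0 v w; apply: discriminant_le0 => // t.
suff -> : dotp v (N *m v) + 2 * t * dotp v (N *m w) + t ^+ 2 * dotp w (N *m w)
   = dotp (v + t *: w) (N *m (v + t *: w)) by [].
rewrite mulmxDr -scalemxAr !dotpDr !dotpDl !dotpZr !dotpZl.
have -> : dotp w (N *m v) = dotp v (N *m w) by rewrite dotpC dotp_mxl Nsym.
ring.
Qed.

Lemma quadratic_form_le M : exists2 C, 0 < C &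
  forall v : 'cV[R]_n, dotp v (M *m v) <= C * dotp v v.
Proof.
(* The summand 1 keeps the constant positive even for the zero matrix; its inverse is used below. *)
exists (1 + \sum_i \sum_k `|M i k|) => [|v].
  by rewrite ltr_wpDr // sumr_ge0 // => i _; apply: sumr_ge0.
rewrite mulrDl mul1r; apply: le_trans (_ : _ <= \sum_i \sum_k `|M i k| * dotp v v) _.
  rewrite dotpE; apply: ler_sum => i _; rewrite mxE mulr_sumr.
  apply: ler_sum => k _; rewrite mulrCA.
  apply: le_trans (ler_norm _) _; rewrite normrM ler_wpM2l // normrM.
  by rewrite -sqr_enorm expr2 ler_pM // norm_coord_le_enorm.
rewrite mulr_suml ler_wpDl ?dotp_ge0 //.
by apply: ler_sum => i _; rewrite mulr_suml.
Qed.

(* The supremum [s] of the Rayleigh quotient is an eigenvalue: otherwise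
   [N = s I - M] is positive semidefinite and invertible, and the
   Cauchy-Schwarz inequality for [N], applied to [v] and [N^-1 v], makes it
   positive definite with a uniform constant, so [s] could be lowered. *)
Lemma Rayleigh_le_lambda_max M : M^T = M ->
  forall v, dotp v (M *m v) <= lambda_max M * dotp v v.
Proof.
move=> Msym.
pose Q : set R := [set q | exists2 v : 'cV[R]_n, v != 0 &
  q = dotp v (M *m v) / dotp v v].
have [C C0 MC] := quadratic_form_le M.
have Qub : has_ubound Q.
  exists C => _ [v v0 ->]; rewrite ler_pdivrMr ?dotp_gt0 //.
have Mle s : ubound Q s -> forall v, dotp v (M *m v) <= s * dotp v v.
  move=> Qs v; have [->|v0] := eqVneq v 0.
    by rewrite /dotp !mulmx0 mxE mulr0.
  by rewrite -ler_pdivrMr ?dotp_gt0 //; apply: Qs; exists v.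
move=> v; have [->|v0] := eqVneq v 0; first by rewrite /dotp !mulmx0 mxE mulr0.
have Q0 : Q !=set0 by exists (dotp v (M *m v) / dotp v v); exists v.
set s := sup Q; have Ms : forall v, dotp v (M *m v) <= s * dotp v v.
  by apply: Mle => q Qq; exact: ub_le_sup.
(* Eigenvectors are row vectors here; symmetry of [M] makes [u^T] a column eigenvector, whose
   Rayleigh quotient is [a]. Thus the set of eigenvalues is bounded and its supremum dominates [s]
   once [s] is one of them. *)
have eig_le a : eigenvalue M a -> a <= s.
  case/eigenvalueP => u uM u0.
  have uT0 : u^T != 0 by rewrite -(inj_eq trmx_inj) trmxK trmx0.
  have := Ms u^T; rewrite -{1}Msym -trmx_mul uM linearZ /= dotpZr.
  by rewrite ler_pM2r ?dotp_gt0.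
suff seig : eigenvalue M s.
  apply: le_trans (Ms v) _; rewrite ler_wpM2r ?dotp_ge0 //.
  by apply: ub_le_sup => //; exists s => a; exact: eig_le.
have [//|] := boolP (eigenvalue M s).
rewrite /eigenvalue /eigenspace negbK kermx_eq0 row_free_unit => Nu; pose N := s%:M - M.
have NN : N = - (M - s%:M) by rewrite opprB.
have Nunit : N \in unitmx by rewrite NN -scaleN1r unitmxZ // unitrN1.
have NE w : N *m w = s *: w - M *m w by rewrite mulmxBl mul_scalar_mx.
have Nsym : N^T = N by rewrite linearB /= tr_scalar_mx Msym.
have N0 w : 0 <= dotp w (N *m w).
  rewrite NE dotpDr dotpZr -scaleN1r dotpZr mulN1r subr_ge0; exact: Ms.
have [K K0 NK] := quadratic_form_le (invmx N).
suff : s <= s - K^-1 by rewrite lerBrDr gerDl leNgt invr_gt0 K0.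
apply: ge_sup => // _ [w w0 ->]; have ww := dotp_gt0 _ w0.
rewrite ler_pdivrMr // mulrBl lerBrDr -lerBrDl.
have <- : dotp w (N *m w) = s * dotp w w - dotp w (M *m w).
  by rewrite NE dotpDr dotpZr -scaleN1r dotpZr mulN1r.
have := psd_CauchySchwarz N Nsym N0 w (invmx N *m w); rewrite mulKVmx // => CS.
have {}CS : dotp w w ^+ 2 <= dotp w (N *m w) * (K * dotp w w).
  by apply: le_trans CS _; rewrite ler_wpM2l // dotpC; exact: NK.
rewrite ler_pdivrMl // -(ler_pM2r ww) -expr2 (le_trans CS) //.
by rewrite mulrA (mulrC K).
Qed.

End Rayleigh.

(** Double counting: every index lies in the same number [c] of samples, and counting incidences in
    two ways gives [m * c = 'C(m, beta) * beta]. *)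
Lemma sum_subsets_mem {R : realType} {m : nat} (beta : nat) (f : 'I_m -> R) :
  (0 < m)%N ->
  \sum_(t : {set 'I_m} | #|t| == beta) \sum_(i in t) f i =
  'C(m, beta)%:R * (beta%:R / m%:R) * \sum_i f i.
Proof.
move=> m0.
(* All samples minus those avoiding a given index; unlike a single binomial in [beta.-1], this is
   also right for [beta = 0]. *)
pose c := ('C(m, beta) - 'C(m.-1, beta))%N.
have cE i : #|[pred t : {set 'I_m} | (#|t| == beta) && (i \in t)]| = c.
  have := card_draws 'I_m beta; rewrite card_ord /c => <-.
  have := cards_draws [set~ i] beta.
  rewrite cardsC1 card_ord => <-.
  rewrite -(cardsID [set t : {set 'I_m} | i \notin t] [set t : {set 'I_m} | #|t| == beta]).
  rewrite addnC; set a := #|_|; set x := #|_|; set y := #|_|.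
  have -> : x = y.
    apply: eq_card => t; rewrite !inE andbC; congr andb.
    apply/idP/fintype.subsetP => [it k kt|ti].
      by rewrite !inE; apply: contraNneq it => <-.
    by apply/negP => /ti; rewrite !inE eqxx.
  by rewrite addnK; apply: eq_card => t; rewrite !inE negbK andbC.
have mc : (m * c = 'C(m, beta) * beta)%N.
  rewrite /c; case: beta {c cE} => [|k]; first by rewrite !bin0 subnn !muln0.
  by rewrite -{2}(prednK m0) binS addKn mul_bin_diag mulnC.
under eq_bigr do rewrite big_mkcond /=.
rewrite exchange_big /= mulr_sumr; apply: eq_bigr => i _.
rewrite -big_mkcondr /= sumr_const cE -[LHS]mulr_natl; congr (_ * _).
have m1 : m%:R != 0 :> R by rewrite pnatr_eq0 -lt0n.
by apply: (mulfI m1); rewrite -natrM mc natrM; field.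
Qed.

(** * One iteration, averaged over the sample *)

(** Conditional expectation given the past: the weight is the probability of each pair in
    [sskm_uniform]. *)
Definition sample_mean {R : realType} {m n : nat} (beta : nat)
    (f : {set 'I_m} -> 'I_n -> R) : R :=
  (\sum_(t : {set 'I_m} | #|t| == beta) \sum_l f t l) *
  ('C(m, beta)%:R^-1 * n%:R^-1).

Section one_step.
Context {R : realType} {m n : nat} (A : 'M[R]_(m, n)) (b : 'cV[R]_m).
Context (beta : nat) (L delta : R).
Hypothesis A_rows : forall i, enorm (row i A)^T = 1.
Hypothesis P0 : polyhedron A b !=set0.
Hypothesis beta_m : (1 <= beta <= m)%N.
Hypothesis n_gt0 : (0 < n)%N.
Hypothesis hL : Hoffman_constant A b L.
Hypothesis hdelta : 0 < delta < 2.

Local Notation dP y := (dist_set y (polyhedron A b)).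
Local Notation r y i := (residual A b y i 0).
Local Notation N := ('C(m, beta)%:R : R).

(** The residual at any admissible [istar], written without [istar] so that the averaging never sees
    how ties are broken. The default 0 is harmless because residuals are nonnegative. *)
Definition max_residual (t : {set 'I_m}) y : R :=
  \big[Num.max/0]_(i in t) r y i.

Let m_gt0 : (0 < m)%N. Proof. by case/andP: beta_m; exact: leq_trans. Qed.
Let m0R : 0 < m%:R :> R. Proof. by rewrite ltr0n m_gt0. Qed.
Let n0R : 0 < n%:R :> R. Proof. by rewrite ltr0n. Qed.
Let beta0R : 0 < beta%:R :> R. Proof. by rewrite ltr0n; case/andP: beta_m. Qed.
Let N0 : 0 < N. Proof. by rewrite ltr0n bin_gt0; case/andP: beta_m. Qed.
Let delta_gt0 : 0 < delta. Proof. by case/andP: hdelta. Qed.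
Let delta_coef_ge0 : 0 <= 2 * delta - delta ^+ 2.
Proof.
by rewrite expr2 -mulrBl mulr_ge0 // ?subr_ge0 ltW //; case/andP: hdelta.
Qed.
Let card_samples : #|[pred t : {set 'I_m} | #|t| == beta]| = 'C(m, beta).
Proof.
by rewrite -[in RHS](card_ord m) -card_draws; apply: eq_card => t; rewrite !inE.
Qed.

Lemma residualE y i : r y i = Num.max ((A *m y) i 0 - b i 0) 0.
Proof. by rewrite !mxE. Qed.

Lemma residual_ge0 y i : 0 <= r y i.
Proof. by rewrite residualE le_max lexx orbT. Qed.

Lemma max_residual_ge0 t y : 0 <= max_residual t y.
Proof. exact: bigmax_ge_id. Qed.

Lemma max_residual_argmax (t : {set 'I_m}) y i : i \in t ->
  (forall k, k \in t -> r y k <= r y i) -> max_residual t y = r y i.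
Proof.
move=> it H; apply/le_anti/andP; split.
  by apply: bigmax_le => //; exact: residual_ge0.
exact: (le_bigmax_cond _ (fun k => r y k)).
Qed.

Let dotp_row y i : dotp (row i A)^T y = (A *m y) i 0.
Proof. by rewrite /dotp trmxK -row_mul mxE. Qed.

Let mulmx_subE (y z : 'cV[R]_n) i : (A *m (y - z)) i 0 = (A *m y) i 0 - (A *m z) i 0.
Proof. by rewrite mulmxBr mxE; congr (_ + _); rewrite mxE. Qed.

Lemma residual_le_norm y z i : polyhedron A b z ->
  r y i <= `|(A *m (y - z)) i 0|.
Proof.
move=> /(_ i) zi; rewrite residualE ge_max normr_ge0 andbT.
by apply: le_trans (ler_norm _); rewrite mulmx_subE lerD2l lerN2.
Qed.

(** For [z] in the polyhedron the residual is at most the scalar product of a unit row with [y - z],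
    in absolute value. *)
Lemma residual_le_dist y i : r y i <= dP y.
Proof.
apply: le_dist_set => // z Pz; apply: le_trans (residual_le_norm _ _ i Pz) _.
rewrite -dotp_row ler_norml -[enorm _]mul1r -(A_rows i) dotp_le andbT.
rewrite -lerN2 opprK -mulN1r -dotpZr; apply: le_trans (dotp_le _ _) _.
by rewrite scaleN1r enormN.
Qed.

Lemma max_residual_le_dist t y : max_residual t y <= dP y.
Proof.
by apply: bigmax_le => [|i _]; [exact: dist_set_ge0|exact: residual_le_dist].
Qed.

Lemma dist_projection_step y i :
  dP (y - (delta * r y i) *: (row i A)^T) ^+ 2 <=
  dP y ^+ 2 - (2 * delta - delta ^+ 2) * r y i ^+ 2.
Proof.
rewrite lerBrDr; apply: le_dist_set_sqr => // z Pz.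
set a := (row i A)^T; set s := r y i; set c := delta * s.
(* Expansion of the square of [y - z - c *: a] with [a] a unit vector. It remains to see that
   [s * dotp a (y - z)] is at least [s ^+ 2]: either [s = 0], or [s] is the violation of constraint
   [i] at [y], and [z] satisfies it. *)
have -> : enorm (y - z) ^+ 2 =
   enorm (y - c *: a - z) ^+ 2 + (2 * delta * (s * dotp a (y - z)) - c ^+ 2).
  rewrite addrAC; move: (y - z) => w; rewrite -scaleNr !sqr_enorm dotpDr !dotpDl !dotpZr !dotpZl.
  rewrite -[dotp a a]sqr_enorm A_rows (dotpC w a) /c; ring.
apply: lerD.
  rewrite ler_sqr ?nnegrE ?enorm_ge0 ?dist_set_ge0 //; exact: dist_set_le.
rewrite /c exprMn mulrBl lerD2r ler_wpM2l //; first by rewrite mulr_ge0 // ltW.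
rewrite dotp_row expr2 /s residualE mulmx_subE.
by have := Pz i; case: (leP _ 0) => h zi; rewrite ?mul0r// ler_pM2l //; lra.
Qed.

Lemma sum_max_residual_ge y :
  N * (mu1 m L * dP y ^+ 2) <=
  \sum_(t : {set 'I_m} | #|t| == beta) max_residual t y ^+ 2.
Proof.
have [L0 /(_ y) HL] := hL.
apply: le_trans (_ : _ <= N * (m%:R^-1 * \sum_i r y i ^+ 2)) _.
  rewrite ler_pM2l // /mu1 invfM mul1r -mulrA ler_pM2l ?invr_gt0 //.
  rewrite ler_pdivrMl ?exprn_gt0 //; apply: le_trans HL _.
  by rewrite sqr_enorm dotpE.
(* With the factor [beta], the squared maximum dominates the sum of squares over the sample, term by
   term. *)
rewrite -(ler_pM2l beta0R) [leRHS]mulr_sumr.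
apply: le_trans (_ : _ <= \sum_(t : {set 'I_m} | #|t| == beta)
   \sum_(i in t) r y i ^+ 2) _.
  rewrite sum_subsets_mem // le_eqVlt; apply/orP; left; apply/eqP; ring.
apply: ler_sum => t /eqP <-; rewrite mulr_natl -sumr_const.
apply: ler_sum => i it; rewrite ler_sqr ?nnegrE ?max_residual_ge0 ?residual_ge0 //.
exact: (le_bigmax_cond _ (fun k => r y k)).
Qed.

(** Rayleigh quotient at a unit row of [A], whose own coordinate in the product is already 1. It
    gives the positivity needed for [mu2] and for dividing by the eigenvalue. *)
Lemma lambda_max_gram_ge1 : 1 <= lambda_max (A^T *m A).
Proof.
pose i0 := Ordinal m_gt0; pose v := (row i0 A)^T.
have := Rayleigh_le_lambda_max (A^T *m A).
rewrite trmx_mul trmxK => /(_ erefl v); rewrite -mulmxA -dotp_mxl.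
rewrite -[dotp v v]sqr_enorm A_rows expr1n mulr1; apply: le_trans.
rewrite dotpE (bigD1 i0) //= -dotp_row -/v -[dotp v v]sqr_enorm A_rows !expr1n.
by rewrite mulr1 lerDl sumr_ge0 // => k _; rewrite -expr2 sqr_ge0.
Qed.

Lemma mu2_gt0 : 0 < mu2 A beta.
Proof.
rewrite lt_min ltr01 /= !mulr_gt0 ?invr_gt0 //.
exact: lt_le_trans lambda_max_gram_ge1.
Qed.

Lemma sum_residual_le y :
  \sum_i r y i ^+ 2 <= lambda_max (A^T *m A) * dP y ^+ 2.
Proof.
have l0 : 0 < lambda_max (A^T *m A) by apply: lt_le_trans lambda_max_gram_ge1.
rewrite mulrC -ler_pdivrMr //; apply: le_dist_set_sqr => // z Pz.
rewrite ler_pdivrMr // mulrC sqr_enorm.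
have := Rayleigh_le_lambda_max (A^T *m A).
rewrite trmx_mul trmxK => /(_ erefl (y - z)); apply: le_trans.
rewrite -mulmxA -dotp_mxl dotpE; apply: ler_sum => i _.
rewrite -expr2 -[leRHS]real_normK ?num_real // ler_sqr ?nnegrE ?residual_ge0 //.
exact: residual_le_norm.
Qed.

(** The two arguments of the minimum are two bounds on the maximum: by the distance, and by the
    Euclidean norm of the sampled residuals, averaged by double counting. *)
Lemma sum_max_residual_le y :
  \sum_(t : {set 'I_m} | #|t| == beta) max_residual t y ^+ 2 <=
  N * (mu2 A beta * dP y ^+ 2).
Proof.
rewrite /mu2 minr_pMl ?sqr_ge0 // (minr_pMr _ _ (ltW N0)) le_min mul1r; apply/andP; split.
  rewrite mulr_natl -card_samples -sumr_const; apply: ler_sum => t _.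
  by rewrite ler_sqr ?nnegrE ?max_residual_ge0 ?dist_set_ge0 // max_residual_le_dist.
apply: le_trans (_ : _ <= \sum_(t : {set 'I_m} | #|t| == beta)
   \sum_(i in t) r y i ^+ 2) _.
  apply: ler_sum => t _; have s0 : 0 <= \sum_(i in t) r y i ^+ 2.
    by apply: sumr_ge0 => i _; exact: sqr_ge0.
  rewrite -[leRHS]sqr_sqrtr // ler_sqr ?nnegrE ?max_residual_ge0 ?sqrtr_ge0 //.
  apply: bigmax_le => [|i it]; first exact: sqrtr_ge0.
  rewrite -[leLHS]ger0_norm ?residual_ge0 // -sqrtr_sqr ler_wsqrtr //.
  by rewrite (bigD1 i) //= lerDl sumr_ge0 // => k _; exact: sqr_ge0.
rewrite sum_subsets_mem // -!mulrA !ler_pM2l ?invr_gt0 //.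
exact: sum_residual_le.
Qed.

Lemma sum_samples_le_sqrt (f : {set 'I_m} -> R) c :
  \sum_(t : {set 'I_m} | #|t| == beta) f t ^+ 2 <= N * c ->
  \sum_(t : {set 'I_m} | #|t| == beta) f t <= N * Num.sqrt c.
Proof.
move=> H; have := sqr_sum_le_card [pred t : {set 'I_m} | #|t| == beta] f.
rewrite card_samples => /le_trans/(_ (ler_wpM2l (ltW N0) H)).
rewrite mulrA -expr2 => /ler_wsqrtr; rewrite sqrtr_sqr sqrtrM ?sqr_ge0 //.
by rewrite sqrtr_sqr (gtr0_norm N0); apply: le_trans; exact: ler_norm.
Qed.

(** Bound from [dist_projection_step] on the distance after the projection part of an iteration, as
    a function of the sample alone. *)
Definition dist_bound (t : {set 'I_m}) y : R :=
  Num.sqrt (dP y ^+ 2 - (2 * delta - delta ^+ 2) * max_residual t y ^+ 2).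

Lemma sum_dist_bound_le y :
  \sum_(t : {set 'I_m} | #|t| == beta) dist_bound t y <=
  N * (Num.sqrt (hfun (mu1 m L) delta) * dP y).
Proof.
have d0 : 0 <= dP y by exact: dist_set_ge0.
have -> : Num.sqrt (hfun (mu1 m L) delta) * dP y =
    Num.sqrt (hfun (mu1 m L) delta * dP y ^+ 2).
  by rewrite mulrC [in RHS]mulrC sqrtrM ?sqr_ge0 // sqrtr_sqr ger0_norm.
apply: sum_samples_le_sqrt.
apply: le_trans (_ : _ <= \sum_(t : {set 'I_m} | #|t| == beta) (dP y ^+ 2 -
    (2 * delta - delta ^+ 2) * max_residual t y ^+ 2)) _.
  apply: ler_sum => t _; rewrite sqr_sqrtr // subr_ge0.
  (* The radicand must be nonnegative, since [Num.sqrt] sends negative numbers to 0; this holds as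
     [2 * delta - delta ^+ 2] is at most 1. *)
  have : max_residual t y ^+ 2 <= dP y ^+ 2.
    by rewrite ler_sqr ?nnegrE ?max_residual_ge0 // max_residual_le_dist.
  apply: le_trans; rewrite ler_piMl ?sqr_ge0 //.
  have := sqr_ge0 (1 - delta); rewrite sqrrB expr1n mul1r; lra.
rewrite sumrB sumr_const card_samples -[_ *+ 'C(_, _)]mulr_natl.
rewrite -[X in _ - X]mulr_sumr.
have := sum_max_residual_ge y; set S := \sum_(_ | _) _ => HS.
have : (2 * delta - delta ^+ 2) * (N * (mu1 m L * dP y ^+ 2)) <=
       (2 * delta - delta ^+ 2) * S.
  by rewrite ler_wpM2l.
rewrite /hfun; lra.
Qed.

(** One summand depends only on the subset and the other only on the coordinate, so the double sum
    splits; [sum_norm_coord_le] bounds the second part. *)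
Lemma sample_mean_le (f : {set 'I_m} -> R) (v : 'cV[R]_n) gamma c :
  0 <= gamma ->
  \sum_(t : {set 'I_m} | #|t| == beta) f t <= N * c ->
  sample_mean beta (fun t l => f t + gamma * `|v l 0|) <=
  c + gamma / Num.sqrt n%:R * enorm v.
Proof.
move=> g0 Hf; rewrite /sample_mean -invfM ler_pdivrMr ?mulr_gt0 //.
under eq_bigr => t _.
  by rewrite big_split /= sumr_const card_ord -mulr_sumr -[_ *+ n]mulr_natl; over.
rewrite big_split /= -mulr_sumr sumr_const card_samples -[_ *+ 'C(_, _)]mulr_natl.
rewrite mulrDl; apply: lerD.
  rewrite [leRHS](_ : _ = n%:R * (N * c)); last by ring.
  by rewrite ler_pM2l.
have sn0 : 0 < Num.sqrt n%:R :> R by rewrite sqrtr_gt0.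
rewrite [leRHS](_ : _ = N * (gamma * (Num.sqrt n%:R * enorm v))).
  by rewrite ler_pM2l // ler_wpM2l // sum_norm_coord_le.
by rewrite -[in N * n%:R](sqr_sqrtr (ltW n0R)); field; rewrite gt_eqF.
Qed.

End one_step.

(** * The two-term linear recursion *)

Section recursion.
Context {R : realType} (p1 p2 p3 p4 g0 : R) (G Z : nat -> R).
Hypotheses (p1_ge0 : 0 <= p1) (p2_ge0 : 0 <= p2) (p3_gt0 : 0 < p3) (p4_ge0 : 0 <= p4).
Hypotheses (p1_lt1 : p1 < 1) (p4_lt1 : p4 < 1).
Hypothesis det_gt0 : p2 * p3 < (1 - p1) * (1 - p4).
Hypotheses (G0 : G 0%N = g0) (Z0 : Z 0%N = 0).
Hypotheses (G_ge0 : forall k, 0 <= G k) (Z_ge0 : forall k, 0 <= Z k).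
Hypothesis GS : forall k, G k.+1 <= p1 * G k + p2 * Z k.
Hypothesis ZS : forall k, Z k.+1 <= p3 * G k + p4 * Z k.

Let D := (p1 - p4) ^+ 2 + 4 * p2 * p3.
Let Gamma1 := (p1 - p4 + Num.sqrt D) / (2 * p3).
Let Gamma2 := (p1 - p4 - Num.sqrt D) / (2 * p3).
Let Gamma3 := p3 / Num.sqrt D.
Let rho1 := 1 / 2 * (p1 + p4 - Num.sqrt D).
Let rho2 := 1 / 2 * (p1 + p4 + Num.sqrt D).

Lemma discr_ge0 : 0 <= D.
Proof. by rewrite addr_ge0 ?sqr_ge0 // !mulr_ge0 // ltW. Qed.

Let sqrtD_ge0 : 0 <= Num.sqrt D. Proof. exact: sqrtr_ge0. Qed.
Let sqr_sqrtD : Num.sqrt D ^+ 2 = D. Proof. by rewrite sqr_sqrtr // discr_ge0. Qed.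

Lemma Gamma3_ge0 : 0 <= Gamma3. Proof. by rewrite divr_ge0 // ltW. Qed.

Lemma norm_rho1_le : `|rho1| <= rho2.
Proof.
have s0 := sqrtD_ge0; have := p1_ge0; have := p4_ge0.
by rewrite ler_norml /rho1 /rho2 => *; apply/andP; split; lra.
Qed.

(** After squaring, the claim is [det_gt0], because the squares of [2 - p1 - p4] and [p1 - p4]
    differ by [4 * (1 - p1) * (1 - p4)]. *)
Lemma rho2_lt1 : rho2 < 1.
Proof.
have := p1_lt1; have := p4_lt1 => h4 h1; have hd := det_gt0.
suff : Num.sqrt D < 2 - p1 - p4 by rewrite /rho2; lra.
rewrite -ltr_sqr ?nnegrE //; last by lra.
rewrite sqr_sqrtD /D; nra.
Qed.

Let Gamma2_le0 : Gamma2 <= 0.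
Proof.
rewrite ler_pdivrMr ?mul0r; last by rewrite mulr_gt0.
rewrite subr_le0; apply: le_trans (ler_norm _) _.
rewrite -sqrtr_sqr ler_wsqrtr // lerDl !mulr_ge0 //; exact: ltW.
Qed.

Let norm_rho1X k : `|rho1 ^+ k| <= rho2 ^+ k.
Proof.
rewrite normrX; apply: lerXn2r; rewrite ?nnegrE //; last exact: norm_rho1_le.
exact: le_trans norm_rho1_le.
Qed.

Section simple_roots.
Hypothesis D0 : D != 0.

Let sqrtD_neq0 : Num.sqrt D != 0.
Proof. by rewrite sqrtr_eq0 -ltNge lt_def D0 discr_ge0. Qed.
Let p3_neq0 : p3 != 0. Proof. by rewrite gt_eqF. Qed.

Let Gamma12 : Gamma1 * Gamma3 = 1 + Gamma2 * Gamma3.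
Proof. by rewrite /Gamma1 /Gamma2 /Gamma3; field; rewrite sqrtD_neq0. Qed.

(** The four identities [eig1] to [eig4] say that [(Gamma1, 1)] and [(Gamma2, 1)] are eigenvectors
    of the recursion matrix for [rho2] and [rho1]. *)
Let eig1 : p1 * Gamma1 + p2 = rho2 * Gamma1.
Proof.
have -> : p2 = (Num.sqrt D ^+ 2 - (p1 - p4) ^+ 2) / (4 * p3).
  by rewrite sqr_sqrtD /D; field.
by rewrite /Gamma1 /rho2; field.
Qed.

Let eig2 : p1 * Gamma2 + p2 = rho1 * Gamma2.
Proof.
have -> : p2 = (Num.sqrt D ^+ 2 - (p1 - p4) ^+ 2) / (4 * p3).
  by rewrite sqr_sqrtD /D; field.
by rewrite /Gamma2 /rho1; field.
Qed.

Let eig3 : p3 * Gamma1 + p4 = rho2.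
Proof. by rewrite /Gamma1 /rho2; field. Qed.

Let eig4 : p3 * Gamma2 + p4 = rho1.
Proof. by rewrite /Gamma2 /rho1; field. Qed.

(** The right-hand sides solve the recursion with equality from [(g0, 0)], being a combination of
    the two eigenvectors; nonnegative coefficients let the bounds propagate by induction. *)
Lemma recursion_closed_form k :
  G k <= (- Gamma2 * Gamma3 * rho1 ^+ k + Gamma1 * Gamma3 * rho2 ^+ k) * g0 /\
  Z k <= (- Gamma3 * rho1 ^+ k + Gamma3 * rho2 ^+ k) * g0.
Proof.
elim: k => [|k [IHG IHZ]].
  by rewrite !expr0 !mulr1 G0 Z0 mulNr Gamma12 addrC addrK mul1r addNr mul0r.
split.
  apply: le_trans (GS k) (le_trans (lerD (ler_wpM2l p1_ge0 IHG) (ler_wpM2l p2_ge0 IHZ)) _).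
  rewrite le_eqVlt; apply/orP; left; apply/eqP; rewrite !exprS.
  transitivity ((- (p1 * Gamma2 + p2) * Gamma3 * rho1 ^+ k +
    (p1 * Gamma1 + p2) * Gamma3 * rho2 ^+ k) * g0); first by ring.
  by rewrite eig1 eig2; ring.
apply: le_trans (ZS k) (le_trans (lerD (ler_wpM2l (ltW p3_gt0) IHG) (ler_wpM2l p4_ge0 IHZ)) _).
rewrite le_eqVlt; apply/orP; left; apply/eqP; rewrite !exprS.
transitivity ((- (p3 * Gamma2 + p4) * Gamma3 * rho1 ^+ k +
  (p3 * Gamma1 + p4) * Gamma3 * rho2 ^+ k) * g0); first by ring.
by rewrite eig3 eig4; ring.
Qed.

Lemma dist_rate_le k :
  (- Gamma2 * Gamma3 * rho1 ^+ k + Gamma1 * Gamma3 * rho2 ^+ k) * g0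
    <= rho2 ^+ k * g0.
Proof.
apply: ler_wpM2r; first by rewrite -G0.
(* By [Gamma12] the excess over [rho2 ^+ k] is [Gamma2 * Gamma3] times a nonnegative difference of
   powers, and [Gamma2] is nonpositive. *)
rewrite Gamma12 mulrDl mul1r addrCA gerDl.
rewrite [leLHS](_ : _ = Gamma2 * Gamma3 * (rho2 ^+ k - rho1 ^+ k)); last by ring.
apply: mulr_le0_ge0; last by rewrite subr_ge0 (le_trans (ler_norm _)).
by apply: mulr_le0_ge0 => //; exact: Gamma3_ge0.
Qed.

Lemma step_rate_le k :
  (- Gamma3 * rho1 ^+ k + Gamma3 * rho2 ^+ k) * g0
    <= 2 * Gamma3 * rho2 ^+ k * g0.
Proof.
apply: ler_wpM2r; first by rewrite -G0.
have := norm_rho1X k; rewrite ler_norml => /andP[h _].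
have := ler_wpM2l Gamma3_ge0 h; lra.
Qed.

End simple_roots.

(** Sum both inequalities over [k < N] and eliminate the sum of [G]: the first is multiplied by
    [p3], the second by [1 - p1]. No eigenvectors enter, so equal roots are allowed. *)
Lemma recursion_sum_le N :
  \sum_(k < N) Z k <= p3 * g0 / ((1 - p1) * (1 - p4) - p2 * p3).
Proof.
set SG := \sum_(k < N) G k; set SZ := \sum_(k < N) Z k.
(* The shifted sum carries the additional term [H N], which is nonnegative. *)
have shift (H : nat -> R) : (forall k, 0 <= H k) ->
    \sum_(k < N) H k <= H 0%N + \sum_(k < N) H k.+1.
  move=> H0; rewrite -[leRHS](big_ord_recl N (fun k : 'I__ => H k)) big_ord_recr /=.
  by rewrite lerDl.
have hG : SG <= g0 + (p1 * SG + p2 * SZ).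
  apply: le_trans (shift _ G_ge0) _; rewrite G0 lerD2l !mulr_sumr -big_split.
  by apply: ler_sum => k _; exact: GS.
have hZ : SZ <= p3 * SG + p4 * SZ.
  apply: le_trans (shift _ Z_ge0) _; rewrite Z0 add0r !mulr_sumr -big_split.
  by apply: ler_sum => k _; exact: ZS.
rewrite ler_pdivlMr ?subr_gt0 //.
have := ler_wpM2l (ltW p3_gt0) hG.
have q1 : 0 <= 1 - p1 by rewrite subr_ge0 ltW.
by have := ler_wpM2l q1 hZ => *; lra.
Qed.

End recursion.

(** * Finitely valued random variables *)

Section finite_valued.
Context {T : Type}.

Lemma sigma_algebraC (F : set (set T)) B :
  sigma_algebra [set: T] F -> F B -> F (~` B).
Proof. by case=> _ FD _ /FD; rewrite setTD. Qed.

Lemma sigma_algebraU (F : set (set T)) B C :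
  sigma_algebra [set: T] F -> F B -> F C -> F (B `|` C).
Proof.
case=> F0 _ FU FB FC; rewrite -bigcup2E; apply: FU => k.
by case: k => [//|[//|k]]; rewrite /bigcup2 /=.
Qed.

Lemma sigma_algebraI (F : set (set T)) B C :
  sigma_algebra [set: T] F -> F B -> F C -> F (B `&` C).
Proof.
move=> SF FB FC; rewrite -[B `&` C]setCK setCI.
by apply: sigma_algebraC => //; apply: sigma_algebraU => //; exact: sigma_algebraC.
Qed.

(** Simple functions measurable for [F], encoded by level sets: [F] can be a bare family of sets and
    [S] carries no sigma-algebra. *)
Definition finite_valued {S : eqType} (F : set (set T)) (X : T -> S) : Prop :=
  (exists s : seq S, forall w, X w \in s) /\
  forall v, F [set w | X w = v].

Lemma finite_valued_cst {S : eqType} (F : set (set T)) (c : S) :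
  sigma_algebra [set: T] F -> finite_valued F (fun=> c).
Proof.
move=> SF; have [F0 _ _] := SF; split=> [|v].
  by exists [:: c] => w; rewrite inE.
have [<-|cv] := eqVneq c v.
  rewrite (_ : mkset _ = ~` set0); first exact: sigma_algebraC.
  by apply/seteqP; split=> w //= _ [].
by rewrite (_ : mkset _ = set0) //; apply/seteqP; split=> // w /= /eqP; rewrite (negbTE cv).
Qed.

Lemma finite_valued_finType {S : finType} (F : set (set T)) (X : T -> S) :
  (forall v, F [set w | X w = v]) -> finite_valued F X.
Proof. by split=> //; exists (enum S) => w; rewrite mem_enum. Qed.

Lemma finite_valued_sub {S : eqType} {F H : set (set T)} {X : T -> S} :
  F `<=` H -> finite_valued F X -> finite_valued H X.
Proof. by move=> FH [Xs FX]; split=> // v; exact: FH. Qed.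

(** A level set of the composite is a finite union of level sets of [X], so [f] can be arbitrary. *)
Lemma finite_valued_comp {S S' : eqType} (F : set (set T)) (X : T -> S)
    (f : S -> S') :
  sigma_algebra [set: T] F -> finite_valued F X -> finite_valued F (f \o X).
Proof.
move=> SF [[s Xs] FX]; split=> [|v].
  by exists (map f s) => w; exact: map_f.
have -> : [set w | (f \o X) w = v] =
    [set w | X w \in [seq u <- s | f u == v]].
  apply/seteqP; split=> w /=; rewrite mem_filter Xs andbT.
    by move=> ->.
  by move/eqP.
elim: [seq u <- s | f u == v] => [|u r IH].
  by have [F0 _ _] := SF; rewrite (_ : mkset _ = set0) //; apply/seteqP; split=> w.
rewrite (_ : mkset _ = [set w | X w = u] `|` [set w | X w \in r]).
  exact: sigma_algebraU.
apply/seteqP; split=> w /=; rewrite inE; first by case/orP => [/eqP|]; [left|right].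
by case=> [->|->]; rewrite ?eqxx ?orbT.
Qed.

Lemma finite_valued_pair {S S' : eqType} (F : set (set T)) (X : T -> S)
    (Y : T -> S') :
  sigma_algebra [set: T] F -> finite_valued F X -> finite_valued F Y ->
  finite_valued F (fun w => (X w, Y w)).
Proof.
move=> SF [[s Xs] FX] [[r Yr] FY]; split=> [|[u v]].
  by exists [seq (a, c) | a <- s, c <- r] => w; exact: allpairs_f.
rewrite (_ : mkset _ = [set w | X w = u] `&` [set w | Y w = v]).
  exact: sigma_algebraI.
by apply/seteqP; split=> w /=; case=> -> ->.
Qed.

Lemma finite_valued_sumE {R : realType} {S : eqType} (X : T -> S) (f : S -> R)
    (s : seq S) : uniq s -> (forall w, X w \in s) ->
  forall w, f (X w) = \sum_(v <- s) f v * \1_[set w' | X w' = v] w.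
Proof.
move=> us Xs w; rewrite (bigD1_seq (X w)) //= big1 => [|v vX].
  by rewrite indicE mem_set // mulr1 addr0.
by rewrite indicE memNset ?mulr0 //= => /esym/eqP; rewrite (negbTE vX).
Qed.

End finite_valued.

Lemma sigma_algebra_measurable {d : measure_display} {T : measurableType d} :
  sigma_algebra [set: T] (@measurable d T).
Proof.
split=> [|B mB|B mB]; [exact: measurable0|exact: measurableD|].
exact: bigcup_measurable.
Qed.

(** * Expectations as finite sums, and averaging over the sample *)

Section expectation_finite_valued.
Context {d : measure_display} {T : measurableType d} {R : realType}.
Context (Pr : probability T R).

Lemma measurable_finite_valued {S : eqType} (X : T -> S) (f : S -> R) :
  finite_valued measurable X -> measurable_fun setT (fun w => f (X w)).
Proof.
case=> [[s Xs] mX].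
rewrite (_ : (fun w => _) = (fun w =>
  \sum_(v <- undup s) f v * \1_[set w' | X w' = v] w)); last first.
  apply/funext => w; apply: finite_valued_sumE; first exact: undup_uniq.
  by move=> w'; rewrite mem_undup.
by apply: measurable_sum => v; apply: measurable_funM => //;
  exact: measurable_indic.
Qed.

Lemma expectation_finite_valued {S : eqType} (X : T -> S) (f : S -> R)
    (s : seq S) : uniq s -> (forall w, X w \in s) ->
  finite_valued measurable X -> (forall v, 0 <= f v) ->
  ('E_Pr[fun w => f (X w)] =
   (\sum_(v <- s) f v * fine (Pr [set w | X w = v]))%:E)%E.
Proof.
move=> us Xs [_ mX] f0; rewrite unlock.
under eq_integral => w _ do rewrite (finite_valued_sumE X f s us Xs) -sumEFin.
rewrite ge0_integral_sum //; last 2 first.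
- move=> v; apply/measurable_EFinP.
  by apply: measurable_funM => //; exact: measurable_indic.
- by move=> v w _; rewrite lee_fin mulr_ge0.
rewrite -sumEFin; apply: eq_bigr => v _.
under eq_integral => w _ do rewrite EFinM.
rewrite ge0_integralZl_EFin //; last first.
  by apply/measurable_EFinP; exact: measurable_indic.
by rewrite integral_indic // setIT EFinM fineK // fin_num_measure.
Qed.

Lemma expectation_lin {S : eqType} (X : T -> S) (f g : S -> R) (a c : R) :
  finite_valued measurable X -> (forall v, 0 <= f v) -> (forall v, 0 <= g v) ->
  0 <= a -> 0 <= c ->
  ('E_Pr[fun w => (a * f (X w) + c * g (X w))%R])%E =
   (a * fine ('E_Pr[fun w => f (X w)])%E +
    c * fine ('E_Pr[fun w => g (X w)])%E)%:E.
Proof.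
move=> fX f0 g0 a0 c0; have [[s Xs] mX] := fX.
have us := undup_uniq s.
have {}Xs w : X w \in undup s by rewrite mem_undup.
rewrite (expectation_finite_valued X (fun v => a * f v + c * g v) _ us Xs) //.
  rewrite !(expectation_finite_valued X _ _ us Xs) //=; congr EFin.
  by rewrite !mulr_sumr -big_split; apply: eq_bigr => v _ /=; ring.
by move=> v; rewrite addr_ge0 ?mulr_ge0.
Qed.

Lemma expectation_fin_num {S : eqType} (X : T -> S) (f : S -> R) :
  finite_valued measurable X -> (forall v, 0 <= f v) ->
  ('E_Pr[fun w => f (X w)] = (fine 'E_Pr[fun w => f (X w)])%:E)%E.
Proof.
move=> fX f0; have [[s Xs] mX] := fX.
have us := undup_uniq s.
have {}Xs w : X w \in undup s by rewrite mem_undup.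
by rewrite (expectation_finite_valued X f _ us Xs).
Qed.

(* Conditionally on the value [v] of the past [Y], the sample [(tau, j)] is
   uniform, so it can be averaged out. *)
Lemma expectation_sample {S : eqType} {m n : nat} (beta : nat) (F : set (set T))
    (Y : T -> S) (tau : T -> {set 'I_m}) (j : T -> 'I_n)
    (f : S -> {set 'I_m} -> 'I_n -> R) :
  F `<=` measurable -> finite_valued F Y ->
  finite_valued measurable tau -> finite_valued measurable j ->
  (forall w, #|tau w| = beta) ->
  (forall (E : set T) (t : {set 'I_m}) (l : 'I_n), F E -> #|t| = beta ->
    Pr (E `&` [set w | tau w = t] `&` [set w | j w = l]) =
    (Pr E * ((('C(m, beta))%:R)^-1 * (n%:R)^-1)%:E)%E) ->
  (forall v t l, 0 <= f v t l) ->
  ('E_Pr[fun w => f (Y w) (tau w) (j w)] =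
   'E_Pr[fun w => sample_mean beta (f (Y w))])%E.
Proof.
move=> FM FY mtau mj tau_card unif f0; have mY := finite_valued_sub FM FY.
have SM := @sigma_algebra_measurable d T.
have [[s Ys] _] := mY; have us := undup_uniq s.
have {}Ys w : Y w \in undup s by rewrite mem_undup.
pose Q := [pred p : {set 'I_m} * 'I_n | #|p.1| == beta].
pose X w := (Y w, (tau w, j w)).
have mX : finite_valued measurable X.
  by do 2?apply: finite_valued_pair.
pose r := [seq (v, p) | v <- undup s, p <- enum Q].
have ur : uniq r.
  by apply: allpairs_uniq => //; [exact: enum_uniq|move=> [? ?] [? ?]].
have Xr w : X w \in r.
  by apply: allpairs_f => //; rewrite mem_enum inE /= tau_card.
rewrite (expectation_finite_valued X (fun x => f x.1 x.2.1 x.2.2) r) //.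
rewrite (expectation_finite_valued Y (fun v => sample_mean beta (f v)) (undup s)) //;
  last first.
  move=> v; rewrite /sample_mean mulr_ge0 ?mulr_ge0 ?invr_ge0 //.
  by do 2!apply: sumr_ge0 => ? _.
congr EFin; rewrite big_allpairs; apply: eq_bigr => v _.
rewrite /sample_mean pair_big_dep big_enum /= -mulrA mulr_suml.
apply: eq_big => [p|p /eqP pbeta]; first by rewrite !inE andbT.
congr (_ * _).
(* Each atom is an event of the past cut by a value of the sample, the form to which [unif]
   applies. *)
rewrite (_ : mkset _ = [set w | Y w = v] `&` [set w | tau w = p.1] `&`
   [set w | j w = p.2]); last first.
  apply/seteqP; split=> w /=; first by case=> <- <-.
  by rewrite /X => -[[-> ->] ->]; rewrite -surjective_pairing.
rewrite unif //; last by case: FY.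
rewrite fineM ?fin_num_measure //=; first by rewrite mulrC.
by case: mY.
Qed.

End expectation_finite_valued.

(** * Almost sure convergence from summable steps *)

Section summable_steps.
Context {R : realType} {n : nat}.

Lemma cvg_of_coord (u : nat -> 'cV[R]_n) :
  (forall i, cvgn (fun k => u k i 0)) -> cvgn u.
Proof.
move=> H; apply/cvg_ex.
exists (\matrix_(i, c) limn (fun k => u k i c)) => /=.
apply/cvg_mx_entourageP => E entE; near=> k => i c.
rewrite inE mxE; move: (i) (c); near: k; apply: filter_forall => i'.
apply: filter_forall => c'; rewrite (ord1 c').
by have /cvg_app_entourageP := H i'; apply.
Unshelve. all: by end_near. Qed.

(** Each coordinate is a telescoping series, absolutely convergent because a coordinate is bounded
    by the Euclidean norm. *)
Lemma cvg_of_summable_steps (u : nat -> 'cV[R]_n) :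
  (\sum_(0 <= k <oo) (enorm (u k.+1 - u k))%:E < +oo)%E -> cvgn u.
Proof.
move=> uoo; apply: cvg_of_coord => i.
have e0 k : (0 <= k)%N -> true -> (0 <= (enorm (u k.+1 - u k))%:E)%E.
  by rewrite lee_fin enorm_ge0.
pose v k := u k i 0.
rewrite (_ : (fun k => _) = (fun k => v 0%N + series (telescope v) k)); last first.
  by apply/funext => k; rewrite -eq_sum_telescope.
apply: is_cvgD; first exact: is_cvg_cst.
apply: normed_cvg; apply: nondecreasing_is_cvgn.
  by apply: nondecreasing_series => k _ _; exact: normr_ge0.
exists (fine (\sum_(0 <= k <oo) (enorm (u k.+1 - u k))%:E)) => _ [N _ <-].
apply: le_trans (_ : _ <= \sum_(0 <= k < N) enorm (u k.+1 - u k)) _.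
  rewrite /series /=; apply: ler_sum => k _.
  by apply: le_trans (norm_coord_le_enorm _ i); rewrite !mxE.
rewrite -lee_fin fineK; last first.
  by rewrite ge0_fin_numE // nneseries_ge0.
by rewrite -sumEFin; exact: nneseries_lim_ge.
Qed.

End summable_steps.

(** Monotone convergence exchanges sum and expectation; a nonnegative function with finite integral
    is finite almost everywhere. *)
Lemma ae_summable {d : measure_display} {T : measurableType d} {R : realType}
    (Pr : probability T R) (f : nat -> T -> R) (C : R) :
  (forall k, measurable_fun setT (f k)) -> (forall k w, 0 <= f k w) ->
  (forall N, (\sum_(k < N) 'E_Pr[f k] <= C%:E)%E) ->
  {ae Pr, forall w, (\sum_(0 <= k <oo) (f k w)%:E < +oo)%E}.
Proof.
move=> mf f0 fC; pose g w := (\sum_(0 <= k <oo) (f k w)%:E)%E.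
have mEf k : measurable_fun setT (EFin \o f k) by exact/measurable_EFinP.
have mg : measurable_fun setT g.
  apply: (ge0_emeasurable_sum (h := fun k => EFin \o f k) (P := xpredT)).
    by move=> k w _ _; rewrite /= lee_fin.
  by move=> k _; exact: mEf.
have g0 w : (0 <= g w)%E by apply: nneseries_ge0 => k _ _; rewrite lee_fin.
have intg : Pr.-integrable setT g.
  apply/integrableP; split => //.
  rewrite (eq_integral g); last by move=> w _; rewrite gee0_abs.
  rewrite integral_nneseries //; last by move=> k w _; rewrite lee_fin.
  apply: le_lt_trans (ltry C); apply: lime_le.
    by apply: is_cvg_nneseries => k _ _; apply: integral_ge0 => w _; rewrite lee_fin.
  apply: nearW => N; rewrite big_mkord; have := fC N.
  by under eq_bigr do rewrite unlock.
have := integrable_ae measurableT intg.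
apply: filterS => w /(_ I); rewrite ge0_fin_numE //.
Qed.

(** * The SSKM iterates *)

Section sskm.
Context {d : measure_display} {T : measurableType d} {R : realType}.
Context {Pr : probability T R} {m n : nat} {A : 'M[R]_(m, n)} {b : 'cV[R]_m}.
Context {beta : nat} {L delta gamma : R} {x0 : 'cV[R]_n}.
Context {F : nat -> set (set T)} {tau : nat -> T -> {set 'I_m}}.
Context {istar : nat -> T -> 'I_m} {j : nat -> T -> 'I_n}.
Context {x : nat -> T -> 'cV[R]_n}.
Hypothesis A_rows : forall i : 'I_m, enorm (row i A)^T = 1.
Hypothesis P0 : polyhedron A b !=set0.
Hypothesis beta_m : (1 <= beta <= m)%N.
Hypothesis n_gt0 : (0 < n)%N.
Hypothesis hL : Hoffman_constant A b L.
Hypothesis hx : SSKM Pr A b beta delta gamma x0 F tau istar j x.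
Hypothesis hdelta : 0 < delta < 2.
Hypothesis gamma_ge0 : 0 <= gamma.

Local Notation dP y := (dist_set y (polyhedron A b)).
Local Notation mean_dist k := (fine ('E_Pr[fun w => dP (x k w)])%E).
Local Notation mean_step k :=
  (fine ('E_Pr[fun w => enorm (x k.+1 w - x k w)])%E).

(** Momentum involves two consecutive iterates, so it is this pair that evolves from its previous
    value and the current choices. *)
Let state k w := (x k.+1 w, x k w).

Lemma sskm_finite_valued k : finite_valued (F k.+1) (state k).
Proof.
have SF := sskm_sigma_algebra hx.
elim: k => [|k IH].
  rewrite (_ : state 0%N = fun=> (x0, x0)); first exact: finite_valued_cst.
  by apply/funext => w; rewrite /state (sskm_x0 hx) (sskm_x1 hx).
have FX : finite_valued (F k.+2) (fun w => (state k w, (istar k.+1 w, j k.+1 w))).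
  apply: finite_valued_pair => //.
    by apply: finite_valued_sub IH; exact: (sskm_filtration hx).
  apply: finite_valued_pair => //; apply: finite_valued_finType => v.
    exact: (sskm_istar_adapted hx).
  exact: (sskm_j_adapted hx).
pose g (s : ('cV[R]_n * 'cV[R]_n) * ('I_m * 'I_n)) := (s.1.1
  - (delta * residual A b s.1.1 s.2.1 0) *: (row s.2.1 A)^T
  + (gamma * (s.1.1 - s.1.2) s.2.2 0) *: delta_mx s.2.2 0, s.1.1).
rewrite (_ : state k.+1 =
  g \o (fun w => (state k w, (istar k.+1 w, j k.+1 w)))).
  exact: finite_valued_comp.
by apply/funext => w; rewrite /state (sskm_step hx).
Qed.

Let state_measurable k : finite_valued measurable (state k).
Proof. by apply: finite_valued_sub (sskm_finite_valued k); exact: (sskm_measurable hx). Qed.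

Lemma mean_distE k : ('E_Pr[fun w => dP (x k.+1 w)] = (mean_dist k.+1)%:E)%E.
Proof.
apply: (expectation_fin_num Pr (state k) (fun v => dP v.1)) => // v.
exact: dist_set_ge0.
Qed.

Lemma mean_stepE k :
  ('E_Pr[fun w => enorm (x k.+1 w - x k w)] = (mean_step k)%:E)%E.
Proof.
apply: (expectation_fin_num Pr (state k) (fun v => enorm (v.1 - v.2))) => // v.
exact: enorm_ge0.
Qed.

Lemma measurable_step k : measurable_fun setT (fun w => enorm (x k.+1 w - x k w)).
Proof. exact: (measurable_finite_valued (state k) (fun v => enorm (v.1 - v.2))). Qed.

Lemma mean_step_ge0 k : 0 <= mean_step k.
Proof. by rewrite fine_ge0 // expectation_ge0 // => w; exact: enorm_ge0. Qed.

Lemma mean_dist_ge0 k : 0 <= mean_dist k.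
Proof. by rewrite fine_ge0 // expectation_ge0 // => w; exact: dist_set_ge0. Qed.

(** Common core of both recursions: [f] stands for the contribution of the projection, the other
    term for the momentum. *)
Lemma sskm_expectation_le k (g : 'cV[R]_n * 'cV[R]_n -> R)
    (f : {set 'I_m} -> 'cV[R]_n -> R) (c : R) :
  (forall v, 0 <= g v) -> (forall t y, 0 <= f t y) -> 0 <= c ->
  (forall w, g (state k.+1 w) <= f (tau k.+1 w) (x k.+1 w) +
     gamma * `|(x k.+1 w - x k w) (j k.+1 w) 0|) ->
  (forall y, \sum_(t : {set 'I_m} | #|t| == beta) f t y <=
     'C(m, beta)%:R * (c * dP y)) ->
  fine ('E_Pr[fun w => g (state k.+1 w)])%E <=
  c * mean_dist k.+1 + gamma / Num.sqrt n%:R * mean_step k.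
Proof.
move=> g0 f0 c0 gle fle.
pose phi (v : 'cV[R]_n * 'cV[R]_n) t l := f t v.1 + gamma * `|(v.1 - v.2) l 0|.
have phi0 v t l : 0 <= phi v t l by rewrite addr_ge0 ?mulr_ge0.
have mtau : finite_valued measurable (tau k.+1).
  apply: (finite_valued_sub (sskm_measurable hx (k := k.+2))).
  by apply: finite_valued_finType => t; exact: (sskm_tau_adapted hx).
have mj : finite_valued measurable (j k.+1).
  apply: (finite_valued_sub (sskm_measurable hx (k := k.+2))).
  by apply: finite_valued_finType => t; exact: (sskm_j_adapted hx).
have SM := @sigma_algebra_measurable d T.
have q0 : 0 <= gamma / Num.sqrt n%:R by rewrite divr_ge0.
rewrite -lee_fin -(expectation_fin_num Pr _ g (state_measurable _)) //.
rewrite -(expectation_lin Pr (state k) (fun v => dP v.1)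
  (fun v => enorm (v.1 - v.2)) c _ (state_measurable _)) //; last 2 first.
- by move=> v; exact: dist_set_ge0.
- by move=> v; exact: enorm_ge0.
(* The dominating integrand involves only the past and the uniform sample, no longer [istar], so the
   sample can be averaged out. *)
apply: (@le_trans _ _ ('E_Pr[fun w => phi (state k w) (tau k.+1 w) (j k.+1 w)])%E).
  apply: expectation_le => //.
  - exact: measurable_finite_valued.
  - apply: (measurable_finite_valued
      (fun w => (state k w, (tau k.+1 w, j k.+1 w)))
      (fun s => phi s.1 s.2.1 s.2.2)).
    apply: finite_valued_pair => //.
    exact: finite_valued_pair.
  - exact: aeW.
rewrite (expectation_sample Pr beta (F k.+1) (state k)) //; first last.
- exact: (sskm_uniform hx).
- by move=> w; exact: (sskm_tau_size hx).
- exact: sskm_finite_valued.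
- exact: (sskm_measurable hx).
apply: expectation_le.
- exact: (measurable_finite_valued (state k) (fun v => sample_mean beta (phi v))).
- exact: (measurable_finite_valued (state k)
    (fun v => c * dP v.1 + gamma / Num.sqrt n%:R * enorm (v.1 - v.2))).
- move=> w; rewrite /sample_mean mulr_ge0 ?mulr_ge0 ?invr_ge0 //.
  by do 2!apply: sumr_ge0 => ? _.
- by move=> w; rewrite addr_ge0 ?mulr_ge0 ?dist_set_ge0 ?enorm_ge0.
by apply: aeW => w; exact: sample_mean_le.
Qed.

Let max_residual_istar k w :
  max_residual A b (tau k.+1 w) (x k.+1 w) =
  residual A b (x k.+1 w) (istar k.+1 w) 0.
Proof.
apply: max_residual_argmax => [|i]; first exact: (sskm_istar_mem hx).
exact: (sskm_istar_max hx).
Qed.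

Let enorm_momentum k w :
  enorm ((gamma * (x k.+1 w - x k w) (j k.+1 w) 0) *: delta_mx (j k.+1 w) 0 : 'cV[R]_n)
  = gamma * `|(x k.+1 w - x k w) (j k.+1 w) 0|.
Proof. by rewrite enormZ enorm_delta mulr1 normrM ger0_norm. Qed.

(** The distance is 1-Lipschitz, which splits off the momentum; the rest is a relaxed projection
    step. *)
Lemma mean_dist_rec k :
  mean_dist k.+2 <= Num.sqrt (hfun (mu1 m L) delta) * mean_dist k.+1 +
                    gamma / Num.sqrt n%:R * mean_step k.
Proof.
apply: (sskm_expectation_le k (fun v => dP v.1) (dist_bound A b delta)).
- by move=> v; exact: dist_set_ge0.
- by move=> t y; exact: sqrtr_ge0.
- exact: sqrtr_ge0.
- move=> w; rewrite /= (sskm_step hx) //=.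
  apply: le_trans (dist_set_lipschitz _ P0 _ _) _.
  rewrite enorm_momentum lerD2r /dist_bound max_residual_istar.
  rewrite -[leLHS]ger0_norm ?dist_set_ge0 // -sqrtr_sqr ler_wsqrtr //.
  exact: dist_projection_step.
- by move=> y; exact: sum_dist_bound_le.
Qed.

Lemma mean_step_rec k :
  mean_step k.+1 <= delta * Num.sqrt (mu2 A beta) * mean_dist k.+1 +
                    gamma / Num.sqrt n%:R * mean_step k.
Proof.
have delta0 : 0 <= delta by case/andP: hdelta => /ltW.
apply: (sskm_expectation_le k (fun v => enorm (v.1 - v.2))
  (fun t y => delta * max_residual A b t y)).
- by move=> v; exact: enorm_ge0.
- by move=> t y; rewrite mulr_ge0 // max_residual_ge0.
- by rewrite mulr_ge0 // sqrtr_ge0.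
(* The current iterate cancels, leaving the projection displacement along a unit row plus the
   momentum. *)
- move=> w; rewrite /= (sskm_step hx (k := k.+1)) //= addrAC (addrAC (x _ _)).
  rewrite subrr sub0r; apply: le_trans (enormD _ _) _.
  rewrite enormN enormZ A_rows mulr1 max_residual_istar enorm_momentum lerD2r.
  by rewrite ger0_norm // mulr_ge0 // residual_ge0.
- move=> y; rewrite -mulr_sumr [leRHS](_ : _ =
    delta * ('C(m, beta)%:R * (Num.sqrt (mu2 A beta) * dP y))); last by ring.
  rewrite ler_wpM2l //.
  rewrite -(ger0_norm (dist_set_ge0 _ P0 y)) -sqrtr_sqr -sqrtrM; last first.
    by rewrite ltW // mu2_gt0.
  by apply: sum_samples_le_sqrt => //; exact: sum_max_residual_le.
Qed.

Lemma mean_dist1 : mean_dist 1 = dP x0.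
Proof.
rewrite (_ : (fun w => _) = cst (dP x0)) ?expectation_cst //.
by apply/funext => w; rewrite (sskm_x1 hx).
Qed.

Lemma mean_step0 : mean_step 0 = 0.
Proof.
rewrite (_ : (fun w => _) = cst 0) ?expectation_cst //.
by apply/funext => w; rewrite (sskm_x1 hx) (sskm_x0 hx) subrr enorm0.
Qed.

End sskm.

(** * Convergence and rates from the recursion *)

Theorem theorem6p15 (d : measure_display) (T : measurableType d) (R : realType)
    (Pr : probability T R) (m n : nat) (A : 'M[R]_(m, n)) (b : 'cV[R]_m)
    (beta : nat) (L delta gamma : R) (x0 : 'cV[R]_n)
    (F : nat -> set (set T)) (tau : nat -> T -> {set 'I_m})
    (istar : nat -> T -> 'I_m) (j : nat -> T -> 'I_n)
    (x : nat -> T -> 'cV[R]_n)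
    (hA : forall i : 'I_m, enorm (row i A)^T = 1)
    (hP : polyhedron A b !=set0)
    (hbeta : (1 <= beta <= m)%N)
    (hL : Hoffman_constant A b L)
    (hx : SSKM Pr A b beta delta gamma x0 F tau istar j x)
    (hdelta : 0 < delta < 2)
    (hgamma : 0 <= gamma)
    (hparam : gamma * delta * Num.sqrt (mu2 A beta) <
      (Num.sqrt n%:R - gamma) * (1 - Num.sqrt (hfun (mu1 m L) delta))) :
  let Pi1 := Num.sqrt (hfun (mu1 m L) delta) in
  let Pi2 := gamma / Num.sqrt n%:R in
  let Pi3 := delta * Num.sqrt (mu2 A beta) in
  let Pi4 := gamma / Num.sqrt n%:R in
  let D := (Pi1 - Pi4) ^+ 2 + 4 * Pi2 * Pi3 in
  let Gamma1 := (Pi1 - Pi4 + Num.sqrt D) / (2 * Pi3) in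
  let Gamma2 := (Pi1 - Pi4 - Num.sqrt D) / (2 * Pi3) in
  let Gamma3 := Pi3 / Num.sqrt D in
  let rho1 := 1 / 2 * (Pi1 + Pi4 - Num.sqrt D) in
  let rho2 := 1 / 2 * (Pi1 + Pi4 + Num.sqrt D) in
  let dP := fun y => dist_set y (polyhedron A b) in
  {ae Pr, forall w, cvgn (fun k => x k w)} /\
  (* if D = 0 then Gamma3 has denominator 0 and is not defined *)
  (D != 0 -> forall k : nat,
    [/\ ('E_Pr[fun w => dP (x k.+1 w)] <=
           ((- Gamma2 * Gamma3 * rho1 ^+ k + Gamma1 * Gamma3 * rho2 ^+ k)
            * dP x0)%:E)%E,
        (- Gamma2 * Gamma3 * rho1 ^+ k + Gamma1 * Gamma3 * rho2 ^+ k) * dP x0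
          <= rho2 ^+ k * dP x0,
        ('E_Pr[fun w => enorm (x k.+1 w - x k w)] <=
           ((- Gamma3 * rho1 ^+ k + Gamma3 * rho2 ^+ k) * dP x0)%:E)%E
      & (- Gamma3 * rho1 ^+ k + Gamma3 * rho2 ^+ k) * dP x0
          <= 2 * Gamma3 * rho2 ^+ k * dP x0]) /\
  [/\ 0 <= Gamma3, 0 <= `|rho1|, `|rho1| <= rho2 & rho2 < 1].
Proof.
move=> Pi1 Pi2 Pi3 Pi4 D Gamma1 Gamma2 Gamma3 rho1 rho2 dP.
have m_gt0 : (0 < m)%N by case/andP: hbeta; exact: leq_trans.
have delta_gt0 : 0 < delta by case/andP: hdelta.
have mu2_pos : 0 < mu2 A beta by exact: mu2_gt0.
have Pi1_ge0 : 0 <= Pi1 by exact: sqrtr_ge0.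
have Pi1_le1 : Pi1 <= 1.
  rewrite -sqrtr1 ler_wsqrtr // /hfun gerBl mulr_ge0 //.
    by rewrite expr2 -mulrBl mulr_ge0 // ?subr_ge0 ltW //; case/andP: hdelta.
  by rewrite divr_ge0 // mulr_ge0 // sqr_ge0.
(* The left side of [hparam] is nonnegative, so this product is positive. As [Pi1 <= 1], both
   factors are positive, and [gamma < Num.sqrt n%:R] then forces [n] to be positive. *)
have hpos : 0 < (Num.sqrt n%:R - gamma) * (1 - Pi1).
  apply: le_lt_trans hparam; rewrite !mulr_ge0 ?sqrtr_ge0 //; exact: ltW.
have Pi1_lt1 : Pi1 < 1.
  by rewrite lt_neqAle Pi1_le1 andbT; apply: contraTneq hpos => ->; rewrite subrr mulr0 ltxx.
have gamma_lt : gamma < Num.sqrt n%:R.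
  by move: hpos; rewrite pmulr_lgt0 ?subr_gt0.
have n_gt0 : (0 < n)%N.
  by rewrite -(ltr0n R) -sqrtr_gt0; exact: le_lt_trans gamma_lt.
have sn0 : 0 < Num.sqrt n%:R :> R by rewrite sqrtr_gt0 ltr0n.
have Pi2_ge0 : 0 <= Pi2 by rewrite divr_ge0.
have Pi4_lt1 : Pi4 < 1 by rewrite ltr_pdivrMr // mul1r.
have Pi3_gt0 : 0 < Pi3 by rewrite mulr_gt0 // sqrtr_gt0.
(* This is [hparam] divided by [Num.sqrt n%:R]. *)
have det : Pi2 * Pi3 < (1 - Pi1) * (1 - Pi4).
  rewrite -(ltr_pM2l sn0).
  have -> : Num.sqrt n%:R * (Pi2 * Pi3) = gamma * delta * Num.sqrt (mu2 A beta).
    by rewrite /Pi2 /Pi3; field; rewrite gt_eqF.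
  have -> : Num.sqrt n%:R * ((1 - Pi1) * (1 - Pi4)) =
            (Num.sqrt n%:R - gamma) * (1 - Pi1).
    by rewrite /Pi4; field; rewrite gt_eqF.
  exact: hparam.
pose G k := fine ('E_Pr[fun w => dP (x k.+1 w)])%E.
pose Z k := fine ('E_Pr[fun w => enorm (x k.+1 w - x k w)])%E.
have G0 : G 0%N = dP x0 := mean_dist1 hx.
have Z0 : Z 0%N = 0 := mean_step0 hx.
have G_ge0 k : 0 <= G k by exact: mean_dist_ge0.
have Z_ge0 k : 0 <= Z k by exact: mean_step_ge0.
have GS k : G k.+1 <= Pi1 * G k + Pi2 * Z k 
  by exact: (mean_dist_rec hA hP hbeta n_gt0 hL hx hdelta hgamma k).
have ZS k : Z k.+1 <= Pi3 * G k + Pi4 * Z k 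
  by exact: (mean_step_rec hA hP hbeta n_gt0 hx hdelta hgamma k).
split; last split.
- have := ae_summable Pr (fun k w => enorm (x k.+1 w - x k w))
    (Pi3 * dP x0 / ((1 - Pi1) * (1 - Pi4) - Pi2 * Pi3)).
  have H : forall N, (\sum_(k < N) 'E_Pr[fun w => enorm (x k.+1 w - x k w)] <=
      (Pi3 * dP x0 / ((1 - Pi1) * (1 - Pi4) - Pi2 * Pi3))%:E)%E.
    move=> N; under eq_bigr do rewrite (mean_stepE hx).
    by rewrite sumEFin lee_fin; exact: (recursion_sum_le _ _ _ _ _ G Z).
  move=> /(_ (measurable_step hx) (fun k w => enorm_ge0 _) H).
  by apply: filterS => w; exact: cvg_of_summable_steps.
- move=> D0 k.
  (* [Pi2_ge0] serves twice, since [Pi4] unfolds to the same quotient as [Pi2]. *)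
  have [HG HZ] := recursion_closed_form Pi1 Pi2 Pi3 Pi4 _ G Z Pi1_ge0 Pi2_ge0
    Pi3_gt0 Pi2_ge0 G0 Z0 GS ZS D0 k.
  split.
  + by rewrite (mean_distE hP hx) lee_fin.
  + exact: (dist_rate_le Pi1 Pi2 Pi3 Pi4 _ G).
  + by rewrite (mean_stepE hx) lee_fin.
  + exact: (step_rate_le Pi1 Pi2 Pi3 Pi4 _ G).
(* These claims include [D = 0]: the inverse of 0 is 0, so [Gamma3] is then 0. *)
- split=> //.
  + exact: Gamma3_ge0.
  + exact: norm_rho1_le.
  + exact: rho2_lt1.
Qed.
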